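(* For all positive integers $r$, $m$, and $l$ there exists a positive integer $n$ such that for every coloring with $r$ colors of the $\mathbf{m}^2$ subposets of $\mathbf{n}^2$, there is an $\mathbf{l}^2$ subposet $P$ of $\mathbf{n}^2$ such that every $\mathbf{m}^2$ subposet of $P$ receives the same color.
   Context: $\mathbf{k}$ denotes the $k$-element chain and $\mathbf{k}^2$ the product poset on $[k]^2$ with $(i_1,i_2)\le(j_1,j_2)$ iff $i_1\le j_1$ and $i_2\le j_2$. For posets $A$ and $B$, a ''$B$ subposet'' of $A$ means a subset of the ground set of $A$ whose induced subposet is isomorphic to $B$ (not necessarily a product of subsets of coordinates). *)

(* Defs.v *)
From HB Require Import structures.
From mathcomp Require Export all_boot all_order.

Set Implicit Arguments.
Unset Strict Implicit.
Unset Printing Implicit Defensive.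

Local Open Scope order_scope.

(* The poset k^2: *p carries the componentwise order, and the underlying set
   [k] is encoded as {0, .., k - 1}. *)
Notation grid k := ('I_k *p 'I_k).

Definition induced (d : Order.disp_t) (A : finPOrderType d) (S : {set A}) : Type :=
  {x : A | x \in S}.

HB.instance Definition _ (d : Order.disp_t) (A : finPOrderType d) (S : {set A}) :=
  SubFinite.on (induced S).
HB.instance Definition _ (d : Order.disp_t) (A : finPOrderType d) (S : {set A}) :=
  [SubChoice_isSubPOrder of induced S by <: with d].

Definition poset_iso (d1 d2 : Order.disp_t) (A : porderType d1)
    (B : porderType d2) : Prop :=
  exists2 f : A -> B, bijective f & forall x y : A, (f x <= f y) = (x <= y).

Definition is_subposet (d1 d2 : Order.disp_t) (A : finPOrderType d1)
    (B : porderType d2) (S : {set A}) : Prop :=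
  poset_iso (induced S) B.

(* Main.v *)
Require Import Defs.
From mathcomp Require Import zify.

(** Suppose that no two points of an [m^2] subposet of [n^2] share a coordinate.
    Moving one point of an incomparable pair along a comparability does not change
    which point of the pair lies to the left, and all incomparable pairs of [m^2]
    are connected by such moves.  Hence, up to exchanging the factors of [m^2],
    the points appear in lexicographic order along the first axis and in
    colexicographic order along the second, so the subposet is determined by its
    two coordinate projections, which have [m^2] elements each.  Product Ramsey
    for pairs of [m^2]-element sets gives [X] and [Y] with [l^2] elements, and [P]
    is the copy of [l^2] with these projections; its points share no coordinate. *)

Set Implicit Arguments.
Unset Strict Implicit.
Unset Printing Implicit Defensive.

Import Order.TTheory.

(** * Ramsey's theorem for sets and for pairs of sets *)

Lemma ramsey (C : finType) (k l : nat) : exists N : nat,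
  forall (T : finType) (V : {set T}) (c : {set T} -> C), N <= #|V| ->
  exists W : {set T}, [/\ W \subset V, #|W| = l &
    exists a, forall X : {set T}, X \subset W -> #|X| = k -> c X = a].
Proof.
elim: k l => [|k IHk] l.
  exists l => T V c hV.
  have [W [sWV cW]] : exists W : {set T}, W \subset V /\ #|W| = l.
    have : 0 < #|[set A : {set T} | A \subset V & #|A| == l]|.
      by rewrite cards_draws bin_gt0.
    by case/card_gt0P=> W; rewrite inE => /andP[? /eqP ?]; exists W.
  by exists W; split=> //; exists (c set0) => X _ /cards0_eq ->.
(* Each colour [a] gets its own target size [g a], which allows induction on a bound [t] for the sum
   of the targets. *)
suff H t : exists N : nat, forall g : C -> nat, \sum_a g a <= t ->
    forall (T : finType) (V : {set T}) (c : {set T} -> C), N <= #|V| ->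
    exists (W : {set T}) (a : C), [/\ W \subset V, #|W| = g a &
      forall X : {set T}, X \subset W -> #|X| = k.+1 -> c X = a].
  have [N HN] := H (\sum_(a : C) l); exists N => T V c hV.
  have [W [a [sWV cW hW]]] := HN (fun=> l) (leqnn _) T V c hV.
  by exists W; split=> //; exists a.
have trivial_case (g : C -> nat) (a : C) (T : finType) (V : {set T})
    (c : {set T} -> C) : g a = 0 ->
    exists (W : {set T}) (a : C), [/\ W \subset V, #|W| = g a &
      forall X : {set T}, X \subset W -> #|X| = k.+1 -> c X = a].
  move=> ga0; exists set0, a; split; rewrite ?sub0set ?cards0 //.
  by move=> X; rewrite subset0 => /eqP ->; rewrite cards0.
elim: t => [|t [N IHt]].
  (* All targets are 0 here; [c set0] supplies a colour to name. *)
  exists 0 => g hg T V c _; apply: (trivial_case _ (c set0)).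
  by apply/eqP; rewrite -leqn0 (leq_trans _ hg) // (bigD1 (c set0)) //= leq_addr.
(* Fix a vertex [x] and colour a [k]-set by adding [x] to it. A set [W0] homogeneous for this
   colouring, with colour [a], has room for the inner induction. *)
have [M HM] := IHk N; exists M.+1 => g hg T V c hV.
have /card_gt0P[x xV] : 0 < #|V| by apply: leq_trans hV.
have hVx : M <= #|V :\ x| by move: hV; rewrite (cardsD1 x V) xV.
have [W0 [sW0 cW0 [a ha]]] := HM T (V :\ x) (fun X => c (x |: X)) hVx.
case ga : (g a) => [|p]; first exact: trivial_case ga.
(* The target of [a] drops by one because [x] can be added to any subset of [W0] homogeneous of
   colour [a]. *)
pose g' b := if b == a then p else g b.
have hg' : \sum_b g' b <= t.
  have -> : \sum_b g' b = p + \sum_(b | b != a) g b.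
    rewrite (bigD1 a) //= {1}/g' eqxx; congr (_ + _).
    by apply: eq_bigr => b /negbTE nb; rewrite /g' nb.
  by move: hg; rewrite (bigD1 a) //= ga addSn ltnS.
have [W [b [sW cW hW]]] := IHt g' hg' T W0 c (eq_leq (esym cW0)).
have sWVx := subset_trans sW sW0.
have [eba|nba] := eqVneq b a; last first.
  exists W, b; split=> //; first by apply: subset_trans sWVx (subsetDl _ _).
  by rewrite cW /g' (negbTE nba).
have xW : x \notin W by apply/negP => /(subsetP sWVx); rewrite !inE eqxx.
exists (x |: W), b; split.
- by rewrite subUset sub1set xV (subset_trans sWVx (subsetDl _ _)).
- by rewrite cardsU1 xW cW /g' eba eqxx ga.
move=> X sX cX; have [xX|xX] := boolP (x \in X); last first.
  by apply: hW => //; rewrite -(setU1K xW) subsetD1 sX xX.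
rewrite eba -(setD1K xX); apply: ha.
  by rewrite (subset_trans _ sW) // subDset.
by move: cX; rewrite (cardsD1 x X) xX => -[].
Qed.

(** Restrict the first factor to [N1] points and colour each [Y] by the whole function sending [X]
    to the colour of the pair. Ramsey makes this function constant in [Y]; the constant [F] then
    colours the sets [X]. Indexing by ['I_N1] keeps the colour type, hence [N2], independent of
    [T]. *)
Lemma product_ramsey (C : finType) (k l : nat) : exists N : nat,
  forall (T : finType) (c : {set T} -> {set T} -> C), N <= #|T| ->
  exists X Y : {set T}, [/\ #|X| = l, #|Y| = l &
    exists a, forall X0 Y0 : {set T}, X0 \subset X -> Y0 \subset Y ->
      #|X0| = k -> #|Y0| = k -> c X0 Y0 = a].
Proof.
have [N1 H1] := ramsey C k l.
have [N2 H2] := ramsey {ffun {set 'I_N1} -> C} k l.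
exists (maxn N1 N2) => T c; rewrite geq_max => /andP[hN1 hN2].
pose j (i : 'I_N1) : T := enum_val (widen_ord hN1 i).
have j_inj : injective j.
  by move=> i i' /enum_val_inj /(congr1 val) /= /val_inj.
have [|Y [_ cY [F hF]]] := H2 T [set: T] (fun Y => [ffun X : {set 'I_N1} => c (j @: X) Y]).
  by rewrite cardsT.
have [|X [_ cX [a ha]]] := H1 'I_N1 [set: 'I_N1] F.
  by rewrite cardsT card_ord.
exists (j @: X), Y; split; rewrite ?card_imset //.
exists a => X0 Y0 sX0 sY0 cX0 cY0.
have eX0 : X0 = j @: (j @^-1: X0).
  apply/setP => x; apply/idP/imsetP => [xX0|[i]]; last by rewrite inE => ? ->.
  by have /imsetP[i _ ex] := subsetP sX0 _ xX0; exists i; rewrite ?inE -?ex.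
have cX1 : #|j @^-1: X0| = k by rewrite -cX0 [in RHS]eX0 card_imset.
have sX1 : j @^-1: X0 \subset X.
  apply/subsetP => i; rewrite inE => /(subsetP sX0) /imsetP[i' hi' /j_inj -> //].
by rewrite -(ha _ sX1 cX1) -(hF _ sY0 cY0) ffunE -eX0.
Qed.

(** * Lexicographic indexing and generic grids *)

Lemma ltn_lexi_index (k a b c d : nat) : b < k -> d < k ->
  (a * k + b < c * k + d) = (a < c) || (a == c) && (b < d).
Proof.
move=> hb hd; case: (ltngtP a c) => /= [h|h|->]; last by rewrite ltn_add2l.
- by nia.
- by apply/negbTE; nia.
Qed.

Lemma sorted_enum_ord (n : nat) (X : {set 'I_n}) : sorted <%O (enum X).
Proof.
rewrite {1}/enum_mem -enumT; apply: sorted_filter; first exact: lt_trans.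
have := iota_ltn_sorted 0 n; rewrite -val_enum_ord sorted_map.
by apply: sub_sorted.
Qed.

Lemma nth_enum_imset_homo (n k : nat) (h : 'I_k -> 'I_n.+1) :
  {homo h : i j / (i < j)%O} ->
  forall i : 'I_k, nth ord0 (enum [set h j | j : 'I_k]) i = h i.
Proof.
move=> h_homo i.
have -> : enum [set h j | j : 'I_k] = [seq h j | j <- enum 'I_k].
  apply: lt_sorted_eq; first exact: sorted_enum_ord.
    apply: (homo_sorted h_homo).
    have := iota_ltn_sorted 0 k; rewrite -val_enum_ord sorted_map.
    by apply: sub_sorted.
  move=> x; rewrite mem_enum; apply/imsetP/mapP => -[j _ ->]; exists j => //.
  by rewrite mem_enum.
by rewrite (nth_map i) ?size_enum_ord // nth_ord_enum.
Qed.

(** Ranks are lexicographic on the first axis and colexicographic on the second. The default [ord0]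
    is never reached when both sets have [k * k] elements. *)
Definition generic_grid (n k : nat) (X Y : {set 'I_n.+1}) (p : grid k) : grid n.+1 :=
  (nth ord0 (enum X) (p.1 * k + p.2), nth ord0 (enum Y) (p.2 * k + p.1)).

Lemma lexi_index_lt (k : nat) (i j : 'I_k) : i * k + j < k * k.
Proof. by have := ltn_ord i; have := ltn_ord j; nia. Qed.

Lemma lexi_index_inj (k : nat) (i j i' j' : 'I_k) :
  i * k + j = i' * k + j' -> (i, j) = (i', j').
Proof.
move=> e; have [hj hj'] := (ltn_ord j, ltn_ord j').
have := ltn_lexi_index i i' hj hj'; have := ltn_lexi_index i' i hj' hj.
rewrite e ltnn => /esym /norP[h1 h2] /esym /norP[h3 h4].
by congr (_, _); apply: val_inj => /=; lia.
Qed.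

Section GenericGrid.
Variables (n k : nat) (X Y : {set 'I_n.+1}).
Hypotheses (cardX : #|X| = k * k) (cardY : #|Y| = k * k).

Let nth_mono (Z : {set 'I_n.+1}) : #|Z| = k * k ->
  {in [pred i | i < k * k] &,
    {mono nth ord0 (enum Z) : i j / (i <= j)%N >-> (i <= j)%O}}.
Proof.
by move=> cZ; have := lt_sorted_leq_nth ord0 (sorted_enum_ord Z); rewrite -cardE cZ.
Qed.

Let nth_inj (Z : {set 'I_n.+1}) : #|Z| = k * k ->
  {in [pred i | i < k * k] &, injective (nth ord0 (enum Z))}.
Proof.
move=> cZ i j hi hj e; apply/eqP.
by rewrite eqn_leq -!(nth_mono cZ) // e lexx.
Qed.

(** The componentwise order is the intersection of the lexicographic and colexicographic orders. *)
Lemma generic_grid_mono : {mono @generic_grid n k X Y : p q / (p <= q)%O}.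
Proof.
move=> [a b] [c d]; rewrite !leEprod /= !nth_mono ?inE ?lexi_index_lt // !leEord /=.
rewrite leqNgt (leqNgt (b * k + a)) !ltn_lexi_index ?ltn_ord //.
by apply/idP/idP; lia.
Qed.

Lemma generic_grid_inj1 : injective (fun p => (@generic_grid n k X Y p).1).
Proof.
move=> [a b] [c d] /= /nth_inj; rewrite !inE !lexi_index_lt.
by move=> /(_ cardX isT isT) /lexi_index_inj.
Qed.

Lemma generic_grid_inj2 : injective (fun p => (@generic_grid n k X Y p).2).
Proof.
move=> [a b] [c d] /= /nth_inj; rewrite !inE !lexi_index_lt.
by move=> /(_ cardY isT isT) /lexi_index_inj [-> ->].
Qed.

Lemma generic_grid_mem (p : grid k) :
  (generic_grid X Y p).1 \in X /\ (generic_grid X Y p).2 \in Y.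
Proof.
by split; rewrite -mem_enum mem_nth // -cardE ?cardX ?cardY lexi_index_lt.
Qed.

End GenericGrid.

(** * Rigidity of embeddings whose points share no coordinate *)

Section Rigidity.
Variables (n k : nat) (g : grid k.+1 -> grid n.+1).
Hypothesis g_mono : {mono g : p q / (p <= q)%O}.
Hypothesis g_inj1 : injective (fun p => (g p).1).
Hypothesis g_inj2 : injective (fun p => (g p).2).

Let leg (p q : grid k.+1) :
  ((g p).1 <= (g q).1) && ((g p).2 <= (g q).2) = (p.1 <= q.1) && (p.2 <= q.2).
Proof. exact: (g_mono p q). Qed.

Let neq1 (p q : grid k.+1) : p != q -> (g p).1 != (g q).1 :> nat.
Proof. by apply: contra => /eqP /val_inj /g_inj1 ->. Qed.

Let neq2 (p q : grid k.+1) : p != q -> (g p).2 != (g q).2 :> nat.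
Proof. by apply: contra => /eqP /val_inj /g_inj2 ->. Qed.

(** Every incomparable pair satisfies [nw] in exactly one of its two orders. *)
Let nw (p q : grid k.+1) := (p.1 < q.1) && (q.2 < p.2).

Let nw_neq p q : nw p q -> p != q.
Proof. by case/andP=> h _; apply: contraTneq h => ->; rewrite ltnn. Qed.

(* Moving one point of an incomparable pair along a comparability keeps the
   left-to-right order of the pair. *)
Let nw_lt_le_r p q q' : nw p q -> nw p q' -> (q <= q')%O ->
  ((g p).1 < (g q).1) = ((g p).1 < (g q').1).
Proof.
(* If [g p] is left of [g q], it is left of [g q'], which is further right. Otherwise
   incomparability puts [g p] below [g q], hence below [g q'], hence to the right of [g q']. *)
move=> h h' hq; have := leg q q'; rewrite -[RHS]/(q <= q')%O hq.
have := neq1 (nw_neq h); have := neq1 (nw_neq h').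
have := leg p q; have := leg q p; have := leg p q'; have := leg q' p.
by move: h h'; rewrite /nw; lia.
Qed.

Let nw_lt_le_l p p' q : nw p q -> nw p' q -> (p <= p')%O ->
  ((g p).1 < (g q).1) = ((g p').1 < (g q).1).
Proof.
move=> h h' hq; have := leg p p'; rewrite -[RHS]/(p <= p')%O hq.
have := neq1 (nw_neq h); have := neq1 (nw_neq h').
have := leg p q; have := leg q p; have := leg p' q; have := leg q p'.
by move: h h'; rewrite /nw; lia.
Qed.

(** Move [q] right to the edge and then down to its corner, and [p] up to the edge and then left to
    its corner. Each move is along a comparability and preserves [nw]. *)
Let nw_lt_corner p q : nw p q ->
  ((g p).1 < (g q).1) = ((g (ord0, ord_max)).1 < (g (ord_max, ord0)).1).
Proof.
case: p q => [a b] [c d] h; move: (h); rewrite /nw /= => /andP[ac db].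
have := ltn_ord a; have := ltn_ord b; have := ltn_ord c; have := ltn_ord d.
move=> hd hc hb ha.
rewrite (@nw_lt_le_r _ _ (ord_max, d)) /nw ?leEprod ?leEord /= ?h; try lia.
rewrite -(@nw_lt_le_r _ (ord_max, ord0)) /nw ?leEprod ?leEord /=; try lia.
rewrite (@nw_lt_le_l _ (a, ord_max)) /nw ?leEprod ?leEord /=; try lia.
by rewrite -(@nw_lt_le_l (ord0, ord_max)) /nw ?leEprod ?leEord /=; lia.
Qed.

(** The guard is there because the two corners coincide when [k = 0]. *)
Hypothesis corner : 0 < k -> (g (ord0, ord_max)).1 < (g (ord_max, ord0)).1.

Let nw_lt p q : nw p q -> (g p).1 < (g q).1.
Proof.
move=> h; rewrite nw_lt_corner // corner //.
by have := ltn_ord q.1; move: h; rewrite /nw; lia.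
Qed.

(** A point lexicographically before [q] is either [nw] of [q] or below it in the grid. *)
Let g1_lexi (p q : grid k.+1) :
  p.1 * k.+1 + p.2 < q.1 * k.+1 + q.2 -> (g p).1 < (g q).1.
Proof.
rewrite ltn_lexi_index ?ltn_ord // => h.
have pq : p != q by apply: contraTneq h => ->; rewrite !ltnn andbF.
have [/nw_lt //|] := boolP (nw p q).
have := leg p q; have := neq1 pq; rewrite /nw; lia.
Qed.

(** Here the incomparable case is [nw q p]: [g q] is to the left of [g p], so it must be above
    it. *)
Let g2_lexi (p q : grid k.+1) :
  p.2 * k.+1 + p.1 < q.2 * k.+1 + q.1 -> (g p).2 < (g q).2.
Proof.
rewrite ltn_lexi_index ?ltn_ord // => h.
have pq : p != q by apply: contraTneq h => ->; rewrite !ltnn andbF.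
have [h'|] := boolP (nw q p).
  have := nw_lt h'; have := leg p q; have := leg q p; have := neq2 pq; move: h'; rewrite /nw; lia.
have := leg p q; have := neq2 pq; rewrite /nw; lia.
Qed.

Let unindex (i : 'I_(k.+1 * k.+1)) : grid k.+1 := (inord (i %/ k.+1), inord (i %% k.+1)).

Let unindexK i : (unindex i).1 * k.+1 + (unindex i).2 = i.
Proof.
rewrite /= !inordK -?divn_eq ?ltn_pmod //.
by rewrite ltn_divLR.
Qed.

(** [X] and [Y] are the coordinate projections of the image of [g]. The coordinates increase along
    the two index orders, so sorted enumeration recovers them. *)
Lemma embedding_generic_lexi : exists X Y : {set 'I_n.+1},
  [/\ #|X| = k.+1 * k.+1, #|Y| = k.+1 * k.+1,
      {in X, forall x, exists p, x = (g p).1},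
      {in Y, forall y, exists p, y = (g p).2} & g =1 generic_grid X Y].
Proof.
pose hx i := (g (unindex i)).1.
(* Exchanging the coordinates of [unindex] turns lexicographic into colexicographic order. *)
pose hy i := (g ((unindex i).2, (unindex i).1)).2.
have hx_homo : {homo hx : i j / (i < j)%O}.
  by move=> i j ij; apply: g1_lexi; rewrite !unindexK.
have hy_homo : {homo hy : i j / (i < j)%O}.
  by move=> i j ij; apply: g2_lexi; rewrite !unindexK.
have homo_inj (h : 'I_(k.+1 * k.+1) -> 'I_n.+1) :
    {homo h : i j / (i < j)%O} -> injective h.
  move=> hh i j e; case: (ltgtP i j) => // /hh; by rewrite e ltxx.
have unindexE i (a b : 'I_k.+1) : val i = a * k.+1 + b -> unindex i = (a, b).
  by move=> e; have := unindexK i; rewrite [RHS]e => /lexi_index_inj; case: (unindex i).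
exists [set hx i | i : 'I_(k.+1 * k.+1)], [set hy i | i : 'I_(k.+1 * k.+1)]; split.
- by rewrite card_imset ?card_ord //; apply: homo_inj.
- by rewrite card_imset ?card_ord //; apply: homo_inj.
- by move=> x /imsetP[i _ ->]; exists (unindex i).
- by move=> y /imsetP[i _ ->]; exists ((unindex i).2, (unindex i).1).
move=> [a b]; rewrite /generic_grid /=.
pose i := Ordinal (lexi_index_lt a b); pose j := Ordinal (lexi_index_lt b a).
rewrite (nth_enum_imset_homo hx_homo i) (nth_enum_imset_homo hy_homo j).
rewrite /hx /hy (unindexE i a b) // (unindexE j b a) //.
by case: (g _).
Qed.

End Rigidity.

(* The grid has the automorphism exchanging its coordinates, so the two possible
   left-to-right orders give the same subsets. *)
Lemma embedding_generic (n k : nat) (g : grid k.+1 -> grid n.+1) :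
    {mono g : p q / (p <= q)%O} ->
    injective (fun p => (g p).1) -> injective (fun p => (g p).2) ->
  exists X Y : {set 'I_n.+1},
  [/\ #|X| = k.+1 * k.+1, #|Y| = k.+1 * k.+1,
      {in X, forall x, exists p, x = (g p).1},
      {in Y, forall y, exists p, y = (g p).2} &
      [set g p | p : grid k.+1] = [set generic_grid X Y p | p : grid k.+1]].
Proof.
move=> g_mono g_inj1 g_inj2.
pose sw (p : grid k.+1) : grid k.+1 := (p.2, p.1).
have swK : involutive sw by case.
have [lt_c|le_c] := boolP ((g (ord0, ord_max)).1 < (g (ord_max, ord0)).1).
  have [X [Y [cX cY hX hY e]]] :=
    embedding_generic_lexi g_mono g_inj1 g_inj2 (fun=> lt_c).
  by exists X, Y; split=> //; apply: eq_imset.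
(* Strictness holds because distinct corners cannot share a first coordinate. *)
have gt_c : 0 < k -> (g (ord_max, ord0)).1 < (g (ord0, ord_max)).1.
  move=> k_gt0; rewrite ltn_neqAle leqNgt le_c andbT.
  by apply/eqP => /val_inj/g_inj1/(congr1 (fun p : grid k.+1 => val p.1)) /=; lia.
have gs_mono : {mono g \o sw : p q / (p <= q)%O}.
  by move=> p q; rewrite /= g_mono !leEprod andbC.
have [||X [Y [cX cY hX hY e]]] := @embedding_generic_lexi n k _ gs_mono _ _ gt_c.
- by move=> p q /g_inj1 /(can_inj swK).
- by move=> p q /g_inj2 /(can_inj swK).
exists X, Y; split=> //.
- by move=> x /hX[p ->]; exists (sw p).
- by move=> y /hY[p ->]; exists (sw p).
rewrite -(eq_imset _ e); apply/setP => z.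
apply/imsetP/imsetP => -[p _ ->]; by exists (sw p); rewrite //= swK.
Qed.

(** * Subposets as images of embeddings, and the Ramsey argument *)

Lemma is_subposet_imset (d1 d2 : Order.disp_t) (A : finPOrderType d1)
    (B : finPOrderType d2) (e : B -> A) :
  {mono e : x y / (x <= y)%O} -> is_subposet B [set e x | x : B].
Proof.
move=> e_mono.
have e_inj := inc_inj e_mono.
pose h (x : B) : induced [set e x | x : B] :=
  exist _ (e x) (imset_f e (isT : x \in B)).
have [f hK fK] : bijective h.
  apply: inj_card_bij => [x y /(congr1 val) /e_inj //|].
  by rewrite card_sig -(card_imset predT e_inj); apply: subset_leq_card; apply/subsetP.
exists f; first by exists h.
by move=> u v; rewrite -[in RHS](fK u) -[in RHS](fK v) -e_mono.
Qed.

Lemma is_subposet_embedding (d1 d2 : Order.disp_t) (A : finPOrderType d1)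
    (B : finPOrderType d2) (S : {set A}) : is_subposet B S ->
  exists2 e : B -> A, {mono e : x y / (x <= y)%O} & S = [set e x | x : B].
Proof.
case=> f [h fK hK] f_mono; exists (fun x => val (h x)).
  by move=> x y; rewrite -[in RHS](hK x) -[in RHS](hK y) f_mono.
apply/setP => z; apply/idP/imsetP => [zS|[x _ ->]]; last exact: (valP (h x)).
by exists (f (exist _ z zS)); rewrite // fK.
Qed.

Theorem theorem6p2 (r m l : nat) (hr : 0 < r) (hm : 0 < m) (hl : 0 < l) :
  exists2 n : nat, 0 < n &
    forall c : {set grid n} -> 'I_r,
      exists2 P : {set grid n}, is_subposet (grid l) P &
        exists a : 'I_r, forall Q : {set grid n},
          Q \subset P -> is_subposet (grid m) Q -> c Q = a.
Proof.
case: m hm => // m _.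
have [N HN] := product_ramsey 'I_r (m.+1 * m.+1) (l * l).
exists N.+1 => // c.
(* A pair of sets receives the colour of the generic copy it determines. *)
have [|X [Y [cX cY [a ha]]]] := HN 'I_N.+1
  (fun X Y => c [set generic_grid X Y p | p : grid m.+1]).
  by rewrite card_ord.
exists [set generic_grid X Y p | p : grid l].
  exact/is_subposet_imset/generic_grid_mono.
exists a => Q sQ /is_subposet_embedding[g g_mono eQ].
have gP p : exists q : grid l, g p = generic_grid X Y q.
  have /(subsetP sQ)/imsetP[q _ ->] : g p \in Q by rewrite eQ imset_f.
  by exists q.
have g_inj := inc_inj g_mono.
(* Copies inside [P] inherit from [P] that no two points share a coordinate, so rigidity applies to
   them. *)
have g_inj1 : injective (fun p => (g p).1).
  move=> p p' e; apply: g_inj; move: e.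
  by have [[q ->] [q' ->]] := (gP p, gP p') => /(generic_grid_inj1 cX) ->.
have g_inj2 : injective (fun p => (g p).2).
  move=> p p' e; apply: g_inj; move: e.
  by have [[q ->] [q' ->]] := (gP p, gP p') => /(generic_grid_inj2 cY) ->.
have [X0 [Y0 [cX0 cY0 hX0 hY0 e]]] := embedding_generic g_mono g_inj1 g_inj2.
(* The projections of [Q] lie in those of [P], that is, in [X] and [Y]. *)
rewrite eQ e; apply: ha => //; apply/subsetP => z.
  by move/hX0 => [p ->]; have [q ->] := gP p; have [] := generic_grid_mem cX cY q.
by move/hY0 => [p ->]; have [q ->] := gP p; have [] := generic_grid_mem cX cY q.
Qed.
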